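(* Let $\tau_{r(m),r_1(m_1)}$ and $\tau_{r(m),r_2(m_2)}$ be class transpositions of $\mathbb{Z}$ (sharing the common vertex $r(m)$). Then $\mathrm{ord}(\tau_{r(m),r_1(m_1)}\cdot\tau_{r(m),r_2(m_2)})\in\{1,3,\infty\}$, and moreover $\mathrm{ord}(\tau_{r(m),r_1(m_1)}\cdot\tau_{r(m),r_2(m_2)})=\infty$ if and only if $$r_1(m_1)\cap r_2(m_2)\neq\emptyset \quad\text{and}\quad r_1(m_1)\neq r_2(m_2).$$
   Context: For a natural number $m>1$ and an integer $r$ with $0\le r<m$, the residue class is $r(m)=r+m\mathbb{Z}=\{r+km \mid k\in\mathbb{Z}\}$. If $r_1(m_1)\cap r_2(m_2)=\emptyset$, the class transposition $\tau_{r_1(m_1),r_2(m_2)}$ is the permutation of $\mathbb{Z}$ which interchanges $r_1+km_1$ and $r_2+km_2$ for each integer $k$ and fixes all other integers. Thus saying that $\tau_{r_1(m_1),r_2(m_2)}$ is a class transposition includes the conditions $m_i>1$, $0\le r_i<m_i$ and $r_1(m_1)\cap r_2(m_2)=\emptyset$. The order $\mathrm{ord}(g)$ of a permutation $g\in\mathrm{Sym}(\mathbb{Z})$ is its order as a group element ($\infty$ if no positive power of $g$ is the identity); products are taken in $\mathrm{Sym}(\mathbb{Z})$. *)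

(* Defs.v *)
From HB Require Import structures.
From mathcomp Require Import all_boot all_order all_algebra.
From mathcomp Require Import boolp classical_sets.
Set Implicit Arguments.
Unset Strict Implicit.
Unset Printing Implicit Defensive.
Import Order.TTheory GRing.Theory Num.Theory.
Local Open Scope classical_set_scope.
Local Open Scope ring_scope.

Record Sym (T : Type) := MkSym {
  sym_fun :> T -> T;
  sym_inv : T -> T;
  sym_funK : cancel sym_fun sym_inv;
  sym_invK : cancel sym_inv sym_fun
}.

Section SymGroup.
Variable T : Type.
Implicit Types s t u : Sym T.

Lemma symP s t : s =1 t -> s = t.
Proof.
case: s t => [f f' fK f'K] [g g' gK g'K] /= fg.
have efg : f = g by apply/funext.
subst g.
have ef : f' = g' by apply/funext => x; rewrite -{1}(g'K x) fK.
subst g'.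
by congr MkSym; exact: Prop_irrelevance.
Qed.

HB.instance Definition _ := gen_eqMixin (Sym T).
HB.instance Definition _ := gen_choiceMixin (Sym T).

Definition sym_one : Sym T := @MkSym T id id (fun=> erefl) (fun=> erefl).

(* Left-to-right product, the convention of the library for {perm T}. *)
Definition sym_mul s t : Sym T :=
  MkSym (can_comp (@sym_funK _ t) (@sym_funK _ s))
        (can_comp (@sym_invK _ s) (@sym_invK _ t)).

Definition sym_opp s : Sym T := MkSym (@sym_invK _ s) (@sym_funK _ s).

Fact sym_mulA : associative sym_mul.
Proof. by move=> s t u; apply: symP. Qed.

Fact sym_mul1s : left_id sym_one sym_mul.
Proof. by move=> s; apply: symP. Qed.

Fact sym_muls1 : right_id sym_one sym_mul.
Proof. by move=> s; apply: symP. Qed.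

Fact sym_mulVs : left_inverse sym_one sym_opp sym_mul.
Proof. by move=> s; apply: symP => x /=; rewrite sym_invK. Qed.

Fact sym_mulsV : right_inverse sym_one sym_opp sym_mul.
Proof. by move=> s; apply: symP => x /=; rewrite sym_funK. Qed.

HB.instance Definition _ := isGroup.Build (Sym T)
  sym_mulA sym_mul1s sym_muls1 sym_mulVs sym_mulsV.

Lemma symM s t x : (s * t)%g x = t (s x).
Proof. by []. Qed.

Lemma sym1 x : (1%g : Sym T) x = x.
Proof. by []. Qed.

End SymGroup.

(* The order of a group element; None stands for infinity. *)
Definition ord (G : groupType) (g : G) : option nat :=
  match pselect (exists n, (0 < n)%N && (g ^+ n == 1)%g) with
  | left h => Some (ex_minn h)
  | right _ => None
  end.

Lemma ord_Some (G : groupType) (g : G) (n : nat) :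
  ord g = Some n <->
  [/\ (0 < n)%N, (g ^+ n)%g = 1%g &
      forall k, (0 < k)%N -> (g ^+ k)%g = 1%g -> (n <= k)%N].
Proof.
rewrite /ord; case: pselect => [h|nh].
  case: ex_minnP => i /andP[i0 /eqP gi] mini; split.
    move=> [<-]; split=> // k k0 gk.
    by apply: mini; rewrite k0 gk eqxx.
  move=> [n0 gn minn]; congr Some; apply/eqP; rewrite eqn_leq minn // andbT.
  by apply: mini; rewrite n0 gn eqxx.
split=> // -[n0 gn _]; case: nh; exists n.
by rewrite n0 gn eqxx.
Qed.

Lemma ord_None (G : groupType) (g : G) :
  ord g = None <-> forall k, (0 < k)%N -> (g ^+ k)%g <> 1%g.
Proof.
rewrite /ord; case: pselect => [h|nh]; split=> //.
  by have [k /andP[k0 /eqP gk]] := h => /(_ k k0).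
by move=> _ k k0 gk; apply: nh; exists k; rewrite k0 gk eqxx.
Qed.

Definition residue_class (r : int) (m : nat) : set int :=
  [set n | exists k : int, n = r + k * m%:Z].

Definition class_pair (r1 : int) (m1 : nat) (r2 : int) (m2 : nat) : Prop :=
  [/\ (1 < m1)%N, 0 <= r1 < m1%:Z, (1 < m2)%N, 0 <= r2 < m2%:Z &
      residue_class r1 m1 `&` residue_class r2 m2 = set0].

Definition class_swap (r1 : int) (m1 : nat) (r2 : int) (m2 : nat) (n : int) :
    int :=
  if n \in residue_class r1 m1 then r2 + ((n - r1) %/ m1%:Z)%Z * m2%:Z
  else if n \in residue_class r2 m2 then r1 + ((n - r2) %/ m2%:Z)%Z * m1%:Z
  else n.

Section ClassTransposition.
Variables (r1 : int) (m1 : nat) (r2 : int) (m2 : nat).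
Hypothesis h : class_pair r1 m1 r2 m2.

Lemma class_swapl k :
  class_swap r1 m1 r2 m2 (r1 + k * m1%:Z) = r2 + k * m2%:Z.
Proof.
case: h => m1_gt1 _ _ _ _; rewrite /class_swap mem_set; last by exists k.
by rewrite addrAC subrr add0r mulzK // eqz_nat -lt0n ltnW.
Qed.

Lemma class_swapr k :
  class_swap r1 m1 r2 m2 (r2 + k * m2%:Z) = r1 + k * m1%:Z.
Proof.
case: h => _ _ m2_gt1 _ dis; rewrite /class_swap memNset; last first.
  move=> n1; have : set0 (r2 + k * m2%:Z) by rewrite -dis; split=> //; exists k.
  by [].
rewrite mem_set; last by exists k.
by rewrite addrAC subrr add0r mulzK // eqz_nat -lt0n ltnW.
Qed.

Lemma class_swap_fix n :
  ~ residue_class r1 m1 n -> ~ residue_class r2 m2 n ->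
  class_swap r1 m1 r2 m2 n = n.
Proof. by move=> n1 n2; rewrite /class_swap !memNset. Qed.

Lemma class_swapK : involutive (class_swap r1 m1 r2 m2).
Proof.
move=> n.
have [[k ->]|n1] := pselect (residue_class r1 m1 n).
  by rewrite class_swapl class_swapr.
have [[k ->]|n2] := pselect (residue_class r2 m2 n).
  by rewrite class_swapr class_swapl.
by rewrite !class_swap_fix.
Qed.

Definition class_transposition : Sym int := MkSym class_swapK class_swapK.

End ClassTransposition.

(* Main.v *)
(** Write [k] for the element of index [k] of r(m).  When r1(m1) and r2(m2)
    meet, put m1 = d a and m2 = d b with a, b coprime, and r1 - r2 = d e.  The
    product sends index [k] to index [k'] as soon as b k' = a k + e, and then
    b y' = a y for the quantity y = (b - a) k - e, which vanishes at the
    (rational) fixed point of this affine map.  As b - a is prime to b, some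
    index has y nonzero and divisible by b^n; its first n iterates all stay in
    r(m), and y is multiplied by (a/b)^n.  If the n-th power of the product is
    the identity then a = b, that is m1 = m2 and the two classes coincide. *)
Require Import Defs.
From HB Require Import structures.
From mathcomp Require Import all_boot all_order all_algebra.
From mathcomp Require Import boolp classical_sets.
From mathcomp Require Import ring zify.
Set Implicit Arguments.
Unset Strict Implicit.
Unset Printing Implicit Defensive.
Import Order.TTheory GRing.Theory Num.Theory.
Local Open Scope classical_set_scope.
Local Open Scope ring_scope.

Lemma residue_class_base r m : residue_class r m r.
Proof. by exists 0; rewrite mul0r addr0. Qed.

Lemma residue_class_disjoint r1 m1 r2 m2 x :
  residue_class r1 m1 `&` residue_class r2 m2 = set0 ->
  residue_class r1 m1 x -> ~ residue_class r2 m2 x.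
Proof.
by move=> dis x1 x2; have : set0 x by rewrite -dis.
Qed.

Lemma residue_class_eq_of_meet r1 r2 m :
  residue_class r1 m `&` residue_class r2 m !=set0 ->
  residue_class r1 m = residue_class r2 m.
Proof.
case=> x [[p ->] [q epq]]; apply/seteqP; split=> y /= [k ->].
  by exists (k + q - p); lia.
by exists (k + p - q); lia.
Qed.

(** Both [r1] and [r1 + m1] lie in the larger class, so their difference [m1] is a multiple of
    [m2]. *)
Lemma residue_class_sub_dvd r1 m1 r2 m2 :
  residue_class r1 m1 `<=` residue_class r2 m2 -> (m2 %| m1)%N.
Proof.
move=> sub; have [i ei] := sub _ (residue_class_base r1 m1).
have [|j ej] := sub (r1 + m1%:Z); first by exists 1; rewrite mul1r.
have : (m2%:Z %| m1%:Z)%Z; last by [].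
by apply/dvdzP; exists (j - i); lia.
Qed.

Lemma residue_class_inj r1 m1 r2 m2 :
  0 <= r1 < m1%:Z -> 0 <= r2 < m2%:Z ->
  residue_class r1 m1 = residue_class r2 m2 -> r1 = r2 /\ m1 = m2.
Proof.
move=> r1_range r2_range e12.
have em : m1 = m2.
  apply/eqP; rewrite eqn_dvd (@residue_class_sub_dvd r2 m2 r1 m1) ?e12 //.
  by rewrite (@residue_class_sub_dvd r1 m1 r2 m2) ?e12.
split=> //; have := residue_class_base r1 m1.
rewrite e12 => -[k ek].
by rewrite -(modz_small r1_range) -(modz_small r2_range) ek -em addrC modzMDl.
Qed.

Lemma symX_S (T : Type) (s : Sym T) n x : (s ^+ n.+1)%g x = (s ^+ n)%g (s x).
Proof. by rewrite expgS. Qed.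

(** A Bezout relation [u * s + v * c = 1] turns [s * (e * u) - e] into [- e * v * c]. If this
    vanishes, moving the index by [c] gives [s * c] instead. *)
Lemma coprime_affine_index (s e c : int) :
  coprimez s c -> s != 0 -> c != 0 ->
  exists k, (c %| s * k - e)%Z /\ s * k - e != 0.
Proof.
move=> /coprimezP[[u v] /= /(canRL (addrK _)) uv] s0 c0.
have [z0|z0] := eqVneq (s * (e * u) - e) 0; last first.
  exists (e * u); split=> //; apply/dvdzP; exists (- e * v).
  by rewrite mulrCA [s * u]mulrC uv; ring.
exists (e * u + c).
have -> : s * (e * u + c) - e = s * c by lia.
by rewrite dvdz_mull // mulf_neq0.
Qed.

Section CommonVertex.
Variables (r : int) (m : nat) (r1 : int) (m1 : nat) (r2 : int) (m2 : nat).
Hypotheses (h1 : class_pair r m r1 m1) (h2 : class_pair r m r2 m2).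
Let g := (class_transposition h1 * class_transposition h2)%g.

Lemma ord_product_same_class :
  residue_class r1 m1 = residue_class r2 m2 -> ord g = Some 1%N.
Proof.
case: (h1) (h2) => _ _ _ r1_range _ [_ _ _ r2_range _] /residue_class_inj.
case=> // er em; apply/ord_Some; split=> //.
by rewrite expg1; apply: symP => x; rewrite symM /= -er -em class_swapK.
Qed.

(** The product moves the three pairwise disjoint classes in a cycle r(m), r1(m1), r2(m2),
    preserving indices, and fixes all other integers. *)
Lemma ord_product_disjoint :
  residue_class r1 m1 `&` residue_class r2 m2 = set0 -> ord g = Some 3%N.
Proof.
case: (h1) (h2) => _ _ _ _ dis1 [_ _ _ _ dis2] dis12.
have dis1' := dis1; rewrite setIC in dis1'.
have dis2' := dis2; rewrite setIC in dis2'.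
have dis21 := dis12; rewrite setIC in dis21.
have fix2 k : class_swap r m r2 m2 (r1 + k * m1%:Z) = r1 + k * m1%:Z.
  have x1 : residue_class r1 m1 (r1 + k * m1%:Z) by exists k.
  by apply: class_swap_fix; apply: residue_class_disjoint x1.
have fix1 k : class_swap r m r1 m1 (r2 + k * m2%:Z) = r2 + k * m2%:Z.
  have x2 : residue_class r2 m2 (r2 + k * m2%:Z) by exists k.
  by apply: class_swap_fix; apply: residue_class_disjoint x2.
have gA k : g (r + k * m%:Z) = r1 + k * m1%:Z.
  by rewrite symM /= (class_swapl h1) fix2.
have gB k : g (r1 + k * m1%:Z) = r2 + k * m2%:Z.
  by rewrite symM /= (class_swapr h1) (class_swapl h2).
have gC k : g (r2 + k * m2%:Z) = r + k * m%:Z.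
  by rewrite symM /= fix1 (class_swapr h2).
(* Exponents 1 and 2 will be excluded at the element of index 0 of r(m), which they send to another
   class. *)
have neq t n : residue_class r m `&` residue_class t n = set0 ->
    r + 0 * m%:Z <> t + 0 * n%:Z.
  move=> dis e0; apply: (@residue_class_disjoint r m t n (r + 0 * m%:Z)) => //.
    by exists 0.
  by rewrite e0; exists 0.
apply/ord_Some; split=> //.
  apply: symP => x; rewrite !symX_S expg0 sym1.
  have [[k ->]|xA] := pselect (residue_class r m x); first by rewrite gA gB gC.
  have [[k ->]|xB] := pselect (residue_class r1 m1 x); first by rewrite gB gC gA.
  have [[k ->]|xC] := pselect (residue_class r2 m2 x); first by rewrite gC gA gB.
  have gx : g x = x by rewrite symM /= !class_swap_fix.
  by rewrite !gx.
case=> [|[|[|k]]] // _ gk; exfalso.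
  have := congr1 (fun s : Sym int => s (r + 0 * m%:Z)) gk.
  by rewrite symX_S expg0 !sym1 gA => /esym; apply: neq.
have := congr1 (fun s : Sym int => s (r + 0 * m%:Z)) gk.
by rewrite !symX_S expg0 !sym1 gA gB => /esym; apply: neq.
Qed.

Lemma product_index_step (k k' : int) :
  r1 + k * m1%:Z = r2 + k' * m2%:Z -> g (r + k * m%:Z) = r + k' * m%:Z.
Proof. by move=> e; rewrite symM /= (class_swapl h1) e (class_swapr h2). Qed.

(** Each step uses up one factor [b] of the quantity y and replaces it by [a], so the induction on
    [n] must range over all [k]. *)
Lemma product_index_iter (a b d : nat) (e : int) :
  m1 = (a * d)%N -> m2 = (b * d)%N -> r1 - r2 = e * d%:Z -> (0 < b)%N ->
  forall n k, (b%:Z ^+ n %| (b%:Z - a%:Z) * k - e)%Z ->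
  exists2 k', (g ^+ n)%g (r + k * m%:Z) = r + k' * m%:Z &
    b%:Z ^+ n * ((b%:Z - a%:Z) * k' - e) = a%:Z ^+ n * ((b%:Z - a%:Z) * k - e).
Proof.
move=> em1 em2 er b0; elim=> [|n IHn] k /dvdzP[t et].
  by exists k; rewrite // expg0 sym1.
(* As [a * k + e] is [b * k] minus y, and y is [t * b ^ n.+1], division by [b] gives this index. *)
pose k1 := k - t * b%:Z ^+ n.
have ek1 : b%:Z * k1 = a%:Z * k + e.
  by rewrite exprS in et; rewrite /k1; lia.
have y1 : (b%:Z - a%:Z) * k1 - e = a%:Z * t * b%:Z ^+ n.
  have bn0 : b%:Z != 0 by rewrite eqz_nat -lt0n.
  by apply: (mulfI bn0); rewrite exprS in et; nia.
have [|k' gk' yk'] := IHn k1; first by rewrite y1 dvdz_mull.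
exists k'.
  rewrite symX_S (@product_index_step k k1) // em1 em2 !PoszM.
  by nia.
by rewrite exprS -mulrA yk' y1 et !exprS; ring.
Qed.

Lemma ord_product_overlap :
  residue_class r1 m1 `&` residue_class r2 m2 !=set0 ->
  residue_class r1 m1 <> residue_class r2 m2 -> ord g = None.
Proof.
move=> meet neq; apply/ord_None => n n0 gn.
have neqm : m1 <> m2.
  move=> em; apply: neq; rewrite em in meet *.
  exact: residue_class_eq_of_meet meet.
case: (h2) => _ _ m2_gt1 _ _; have m2_gt0 := ltnW m2_gt1.
case: meet => x [[p xp] [q xq]].
have d0 : (0 < gcdn m1 m2)%N by rewrite gcdn_gt0 m2_gt0 orbT.
case/dvdnP: (dvdn_gcdl m1 m2) => a em1; case/dvdnP: (dvdn_gcdr m1 m2) => b em2.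
set d := gcdn m1 m2 in d0 em1 em2.
have cop : coprimez a b.
  rewrite coprimezE /= /coprime -(eqn_pmul2r d0) mul1n muln_gcdl.
  by rewrite -em1 -em2.
have b0 : (0 < b)%N by move: m2_gt0; rewrite em2 muln_gt0 => /andP[].
have ab : a != b by apply: contra_notN neqm => /eqP eab; rewrite em1 em2 eab.
(* From [u * a + v * b = 1] follows [- u * (b - a) + (v + u) * b = 1]. *)
have cop_diff : coprimez (b%:Z - a%:Z) (b%:Z ^+ n).
  apply: coprimezXr; case/coprimezP: cop => -[u v] /= uv.
  by apply/coprimezP; exists (- u, v + u) => /=; nia.
(* The common element [x] is [r1 + p * m1] and also [r2 + q * m2]. *)
have er : r1 - r2 = (q * b%:Z - p * a%:Z) * d%:Z.
  have xpq := esym xp; rewrite xq in xpq.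
  by rewrite em1 em2 !PoszM in xpq; nia.
have [||k [kdvd y0]] := coprime_affine_index (q * b%:Z - p * a%:Z) cop_diff.
- by rewrite subr_eq0 eqz_nat eq_sym.
- by rewrite expf_neq0 // eqz_nat -lt0n.
have [k' gk' yk'] := product_index_iter em1 em2 er b0 kdvd.
have ek : k' = k.
  case: (h1) => m_gt1 _ _ _ _.
  have m0 : m%:Z != 0 by rewrite eqz_nat -lt0n ltnW.
  by apply: (mulIf m0); apply: (addrI r); rewrite -gk' gn sym1.
(* Cancelling the nonzero y leaves [b ^ n = a ^ n] with [n] positive, against [a != b]. *)
move: yk'; rewrite ek => /(mulIf y0)/(congr1 absz)/eqP.
by rewrite !abszX eqn_exp2r // eq_sym (negPf ab).
Qed.

End CommonVertex.

Theorem theorem1p1 (r : int) (m : nat) (r1 : int) (m1 : nat)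
    (r2 : int) (m2 : nat)
    (h1 : class_pair r m r1 m1) (h2 : class_pair r m r2 m2) :
  let g := (class_transposition h1 * class_transposition h2)%g in
  [\/ ord g = Some 1%N, ord g = Some 3%N | ord g = None] /\
  (ord g = None <->
     residue_class r1 m1 `&` residue_class r2 m2 !=set0 /\
     residue_class r1 m1 <> residue_class r2 m2).
Proof.
move=> g.
have [same|neq] := pselect (residue_class r1 m1 = residue_class r2 m2).
  have g1 : ord g = Some 1%N by apply: ord_product_same_class.
  by split; [exact: Or31 | rewrite g1; split=> // -[_]].
have [dis|/eqP/set0P meet] :=
    pselect (residue_class r1 m1 `&` residue_class r2 m2 = set0).
  have g3 : ord g = Some 3%N by apply: ord_product_disjoint.
  by split; [exact: Or32 | rewrite g3 dis; split=> // -[[]]].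
have gN : ord g = None by apply: ord_product_overlap.
by split; [exact: Or33 | split].
Qed.
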